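(* Let $K$ be a knot in $S^3$ and let $E_k(K)$, $k\ge 0$, denote the spectral sequence from $\overline{Kh}(K)$ to $\delta$-graded $\widehat{HFK}(m(K))$ described in the context, indexed so that $E_0(K)=\overline{Kh}(K)$. Then the differential $d_k$ has bigrading $(2k+3,\,4k+4)$ with respect to $(\mathrm{gr}_h,\mathrm{gr}_q)$.
   Context: All homologies are over $\mathbb{Q}$. $\overline{Kh}$ is reduced Khovanov homology with homological grading $\mathrm{gr}_h$ and quantum grading $\mathrm{gr}_q$ (differential of bidegree $(1,0)$); $\widehat{HFK}$ is reduced knot Floer homology; $m(K)$ is the mirror of $K$. Diagrams. A decorated partially singular braid diagram $D$ is the closure in $\mathbb{R}^2$ of a braid-like diagram (strands oriented upwards, closed up so that the left-most strand is outermost) each of whose double points is a positive crossing, a negative crossing or a singular point (oriented 4-valent vertex), with one distinguished (decorated) edge. Let $e_1,\dots,e_m$ be the edges of $D$ viewed as a 4-valent graph, $e_1$ the decorated edge, $R=\mathbb{Q}[U_1,\dots,U_m]$, $c(D)$ the set of crossings and $v_4(D)$ the set of singular points. At a double point $v$, $e_a^{(v)},e_b^{(v)}$ are the top-left and top-right (outgoing) edges and $e_c^{(v)},e_d^{(v)}$ the bottom-left and bottom-right (incoming) edges. $\mathrm{sm}(D)$ is the link diagram obtained by replacing each singular point by the unoriented smoothing (joining $e_a$ to $e_b$ and $e_c$ to $e_d$). Resolutions. The 0-resolution of a positive crossing is its singularization (4-valent vertex) and its 1-resolution is the oriented smoothing; for a negative crossing these are exchanged. For $I:c(D)\to\{0,1\}$,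 $D_I$ is the complete resolution with the $I(c)$-resolution at each $c$; it has the same edges as $D$ (smoothings give bivalent vertices). $|I|=\sum_c I(c)$; $v_4(I)$ is the set of 4-valent vertices of $D_I$ coming from crossings of $D$, so $v_4(D_I)=v_4(D)\cup v_4(I)$. For a 4-valent vertex $v$ put $L(v)=U_a^{(v)}+U_b^{(v)}-U_c^{(v)}-U_d^{(v)}$ and $L^+(v)=U_a^{(v)}+U_b^{(v)}+U_c^{(v)}+U_d^{(v)}$. Non-local ideal. For a complete resolution $S$, $N(S)\subset R$ is the ideal generated by $\prod_{e_i\in \mathrm{In}(\Omega)}U_i-\prod_{e_j\in\mathrm{Out}(\Omega)}U_j$ over all smoothly embedded discs $\Omega\subset\mathbb{R}^2$ whose boundary meets $S$ transversely and only in edges and which do not contain the decorated edge $e_1$ (they may intersect it), where $\mathrm{In}(\Omega)$ (resp. $\mathrm{Out}(\Omega)$) is the set of edges meeting $\partial\Omega$ and oriented into (resp. out of) $\Omega$. $\mathcal{D}^{\mathcal R}$ is the family of decorated partially singular braid diagrams $D$ with left-most decorated edge such that for every complete resolution $S=D_I$: $S$ is connected, and the elements $L(v)$, $v\in v_4(I)$, form a regular sequence over $R/N(S)$. Complexes. For $D\in\mathcal{D}^{\mathcal R}$ let $L_I(D_I)$ be the ideal generated by $L(v)$, $v\in v_4(I)$; let $\mathcal{L}_D^+=\bigotimes_{v\in v_4(D)}\big(R\rightleftarrows R\big)$ be the Koszul matrix factorization with forward map $L(v)$ and backward map $L^+(v)$; and $C_2^-(D_I)=R/(N(D_I)+L_I(D_I))\otimes_R\mathcal{L}_D^+$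 with differential $d_0$. If $I\lessdot J$ (they differ at one crossing $c$, $I(c)=0$, $J(c)=1$), the edge map $d_{I,J}:C_2^-(D_I)\to C_2^-(D_J)$ is $\phi\otimes\mathrm{id}$ with $\phi$ the $R$-module map with $\phi(1)=1$ if $c$ is positive and $\phi(1)=U_b^{(v)}-U_c^{(v)}$ if $c$ is negative ($v$ the vertex of $D_J$ at $c$). Put $C_2^-(D)=\bigoplus_I C_2^-(D_I)$ with differential $d_0+d_1$, $d_1=\sum_{I\lessdot J}(-1)^{\epsilon_{I,J}}d_{I,J}$, where $\epsilon$ is a $\mathbb{Z}_2$-valued function on cube edges summing to $1$ around each 2-face. If $\mathrm{sm}(D)$ has $l$ components, choose edges $e_{i_1},\dots,e_{i_l}$, one on each component; the reduced complex is $\widehat{C}_2(D)=C_2^-(D)\otimes_R\bigotimes_{j=1}^l(R\xrightarrow{U_{i_j}}R)$. Gradings. The cube grading is $|I|$ on $C_2^-(D_I)$, and each map $R\xrightarrow{U_{i_j}}R$ raises it by $1$. The relative grading $\mathrm{gr}_2$ has $\mathrm{gr}_2(1\in R/(N(D_I)+L_I(D_I)))=|v_4(D_I)|-|I|$ up to an overall shift, each $U_i$ has degree $-2$, and $\mathcal{L}_D^+$ lies in a single grading; the differential has degree $-2$. The spectral sequence. Choose $D\in\mathcal{D}^{\mathcal R}$ with $\mathrm{sm}(D)$ a diagram for $m(K)$. The spectral sequence is the one induced by the cube filtration on $\widehat{C}_2(D)$, whose page $E_2$ is $\overline{Kh}(K)$ and whose $E_\infty$ page is $\widehat{HFK}(m(K))$;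 on it, $\mathrm{gr}_h$ is the cube grading and $\mathrm{gr}_q=\mathrm{gr}_2+2\,\mathrm{gr}_h$, up to overall shifts. In this spectral sequence the even differentials beyond the $E_2$ page's construction ($d_2,d_4,\dots$) vanish, and $E_k(K)$ is the page numbered $2k+3$ in the cube-filtration indexing (in which the $r$-th differential raises the cube grading by $r$), with $d_k$ its differential. *)

(* Defs.v *)
From HB Require Import structures.
From mathcomp Require Import all_boot all_order all_algebra.
From mathcomp Require Import generic_quotient ring_quotient.
From mathcomp Require Import all_classical all_reals all_analysis.
From mathcomp Require Import -(notations) mpoly.

Set Implicit Arguments.
Unset Strict Implicit.
Unset Printing Implicit Defensive.

Import Order.TTheory GRing.Theory Num.Theory.
Import numFieldNormedType.Exports.

Local Open Scope classical_set_scope.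
Local Open Scope ring_scope.
Local Open Scope quotient_scope.

(** * Ideals and regular sequences *)

Definition ideal_gen (A : comNzRingType) (G : set A) : set A :=
  [set x | exists2 s : seq (A * A),
     {in s, forall ag, G ag.2} & x = \sum_(ag <- s) ag.1 * ag.2].

(** [s] is a regular sequence over [A / (G)]. *)
Definition regular_sequence (A : comNzRingType) (G : set A) (s : seq A) : Prop :=
  (forall i : nat, (i < size s)%N -> forall x : A,
      ideal_gen (G `|` [set` take i s]) (s`_i * x) ->
      ideal_gen (G `|` [set` take i s]) x) /\
  ~ ideal_gen (G `|` [set` s]) 1.

Lemma ideal_genB (A : comNzRingType) (G : set A) (x y : A) :
  ideal_gen G x -> ideal_gen G y -> ideal_gen G (x - y).
Proof.
case=> s Gs -> [t Gt ->].
exists (s ++ [seq (- ag.1, ag.2) | ag <- t]).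
  move=> ag; rewrite mem_cat => /orP[/Gs //|/mapP[bg /Gt Gbg ->]] //.
rewrite big_cat /= big_map -sumrN; congr (_ + _).
by apply: eq_bigr => ag _; rewrite mulNr.
Qed.

Lemma ideal_gen0 (A : comNzRingType) (G : set A) : ideal_gen G 0.
Proof. by exists [::] => //; rewrite big_nil. Qed.

(** * Smooth maps, and knots in the 3-sphere *)

Fixpoint Ck (R : realType) (V W : normedModType R) (k : nat) (f : V -> W) : Prop :=
  continuous f /\
  if k is k'.+1 then
    forall v : V, (forall x, derivable f x v) /\ Ck k' (fun x => 'D_v f x)
  else True.

Definition smooth (R : realType) (V W : normedModType R) (f : V -> W) : Prop :=
  forall k, Ck k f.

Definition dotp (R : realType) (n : nat) (u v : 'rV[R]_n) : R :=
  \sum_i u 0 i * v 0 i.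

Definition sphere3 (R : realType) : set 'rV[R]_4 := [set x | dotp x x = 1].

Definition is_knot (R : realType) (K : set 'rV[R]_4) : Prop :=
  K `<=` @sphere3 R /\
  exists c : R -> 'rV[R]_4,
    [/\ smooth c, forall s, 'D_1 c s != 0, forall s, c (s + 1) = c s,
        {in `[0, 1[ &, injective c} & range c = K].

Definition mirror (R : realType) (K : set 'rV[R]_4) : set 'rV[R]_4 :=
  (fun x : 'rV[R]_4 => \row_i (if i == 2 :> nat then - x 0 i else x 0 i)) @` K.

(** Inverse stereographic projection, identifying [R^3] with the sphere minus
    a point. *)
Definition stereo (R : realType) (y : 'rV[R]_3) : 'rV[R]_4 :=
  \row_i (if insub (i : nat) is Some j then 2 * y 0 j / (dotp y y + 1)
          else (dotp y y - 1) / (dotp y y + 1)).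

Definition ambient_isotopic (R : realType) (K L : set 'rV[R]_4) : Prop :=
  exists H : R * 'rV[R]_4 -> 'rV[R]_4,
    [/\ {within `[0, 1]%classic `*` @sphere3 R, continuous H},
        forall t, `[0, 1]%classic t ->
          set_bij (@sphere3 R) (@sphere3 R) (fun x => H (t, x)),
        forall x, sphere3 x -> H (0, x) = x
      & (fun x => H (1, x)) @` K = L].

(** * Partially singular braid diagrams *)

Inductive dpkind := Positive | Negative | Singular.

Definition is_singular (t : dpkind) : bool :=
  if t is Singular then true else false.

(** A braid-like diagram on [nstr.+1] strands (columns [0 .. nstr], from left
    to right), with [ndp] double points listed from bottom to top; the [j]-th
    one involves the columns [pos j] and [(pos j).+1]. *)
Record diagram := Diagram {
  nstr : nat;
  ndp : nat;
  pos : 'I_ndp -> 'I_nstr;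
  kind : 'I_ndp -> dpkind }.

Arguments pos : clear implicits.
Arguments kind : clear implicits.

Definition touches (D : diagram) (j : 'I_(ndp D)) (k : nat) : bool :=
  (k == pos D j) || (k == (pos D j).+1).

(** The edges of the closure.  [inl (j, b)] is the edge leaving the double
    point [j] at the top left ([b = false]) or at the top right ([b = true]);
    [inr k] is the closed component formed by a column [k] without double
    points. *)
Definition edge (D : diagram) : finType :=
  ('I_(ndp D) * bool +
   {k : 'I_(nstr D).+1 | [forall j : 'I_(ndp D), ~~ touches j k]})%type.

(** Number of levels between the double point [j] and the next (previous) one
    on column [k], going up (down) cyclically around the closure. *)
Definition gap_up (D : diagram) (j : 'I_(ndp D)) (k : nat) : nat :=
  (find (fun s => touches (iter s.+1 (@ordS _) j) k) (iota 0 (ndp D))).+1.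
Definition gap_down (D : diagram) (j : 'I_(ndp D)) (k : nat) : nat :=
  (find (fun s => touches (iter s.+1 (@ord_pred _) j) k) (iota 0 (ndp D))).+1.

Definition out_edge (D : diagram) (j : 'I_(ndp D)) (b : bool) : edge D :=
  inl (j, b).

(** The edge entering [j] at the bottom left ([b = false]) or at the bottom
    right ([b = true]). *)
Definition in_edge (D : diagram) (j : 'I_(ndp D)) (b : bool) : edge D :=
  let k := (pos D j + b)%N in
  let j' := iter (gap_down j k) (@ord_pred _) j in
  inl (j', k != pos D j').

Definition crossing (D : diagram) : finType :=
  {j : 'I_(ndp D) | ~~ is_singular (kind D j)}.
Definition singpt (D : diagram) : finType :=
  {j : 'I_(ndp D) | is_singular (kind D j)}.

(** A vertex [I] of the cube is encoded by the set of crossings [c] with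
    [I(c) = 1].  [vert4 I j]: the double point [j] is a 4-valent vertex of the
    complete resolution [D_I]; otherwise it is smoothed there. *)
Definition vert4 (D : diagram) (I : {set crossing D}) (j : 'I_(ndp D)) : bool :=
  match kind D j with
  | Positive => j \notin [seq val c | c in I]
  | Negative => j \in [seq val c | c in I]
  | Singular => true
  end.

Record decorated := Decorated {
  shape :> diagram;
  deco : edge shape }.

Definition column (D : diagram) (e : edge D) : nat :=
  match e with
  | inl (j, b) => pos D j + b
  | inr k => val k
  end.

(** * Planar and spatial pictures of the closure *)

(** The strip [(x, t)], with columns at [x = 0 .. nstr] and the double point
    [j] at [(pos j + 1/2, j + 1/2)], is closed up by wrapping the vertical
    coordinate [t] clockwise around the origin, so that going up at the left
    of the axis closes up with column [0] outermost. *)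
Definition wrap (R : realType) (D : diagram) (x t : R) : R * R :=
  let theta := 2 * pi * t / (maxn (ndp D) 1)%:R in
  let rho := (nstr D).+1%:R - x in
  (- (rho * cos theta), rho * sin theta).

(** A local model tells where an edge is attached at a double point, by its
    displacement [(x, t)] from the centre of that double point and its height;
    the boolean arguments are: outgoing or incoming edge, right or left side. *)
Definition local_model (R : realType) (D : diagram) :=
  'I_(ndp D) -> forall (out right : bool), R * R * R.

(** In strip coordinates, an edge is a graph over its vertical extent; it is a
    quadratic Bezier arc with control point on its column, so that distinct
    edges are disjoint away from their ends. *)
Definition strip_path (R : realType) (D : diagram) (m : local_model R D)
    (e : edge D) (s : R) : R * R * R :=
  match e with
  | inl (j, b) =>
      let k := (pos D j + b)%N in
      let g := gap_up j k in
      let j' := iter g (@ordS _) j in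
      let: (dx0, dt0, z0) := m j true b in
      let: (dx1, dt1, z1) := m j' false (k != pos D j') in
      ((1 - s) ^+ 2 * ((pos D j)%:R + 2^-1 + dx0) + 2 * s * (1 - s) * k%:R
         + s ^+ 2 * ((pos D j')%:R + 2^-1 + dx1),
       (1 - s) * (j%:R + 2^-1 + dt0) + s * ((j + g)%:R + 2^-1 + dt1),
       (1 - s) ^+ 2 * z0 + s ^+ 2 * z1)
  | inr k => ((val k)%:R, s * (maxn (ndp D) 1)%:R, 0)
  end.

Definition plane_path (R : realType) (D : diagram) (m : local_model R D)
    (e : edge D) (s : R) : 'rV[R]_2 :=
  let: (x, t, z) := strip_path m e s in
  let: (a, b) := wrap D x t in
  \row_i nth 0 [:: a; b] i.

Definition space_path (R : realType) (D : diagram) (m : local_model R D)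
    (e : edge D) (s : R) : 'rV[R]_3 :=
  let: (x, t, z) := strip_path m e s in
  let: (a, b) := wrap D x t in
  \row_i nth 0 [:: a; b; z] i.

(** At a 4-valent vertex the four edges meet; at an oriented smoothing they
    are attached to two bivalent vertices. *)
Definition resolution_model (R : realType) (D : diagram) (I : {set crossing D}) :
    local_model R D := fun j _ right =>
  (if vert4 I j then 0 else if right then 4^-1 else - 4^-1, 0, 0).

Definition res_path (R : realType) (D : diagram) (I : {set crossing D}) :=
  plane_path (resolution_model R I).
Arguments res_path R {D} I e s.

(** [sm(D)]: at a positive crossing the strand from the bottom left to the top
    right is the upper one; a singular point is replaced by a cap joining the
    incoming edges and a cup joining the outgoing ones. *)
Definition sm_model (R : realType) (D : diagram) : local_model R D :=
  fun j out right =>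
  match kind D j with
  | Positive => (0, 0, if out == right then 1 else -1)
  | Negative => (0, 0, if out == right then -1 else 1)
  | Singular => (0, if out then 4^-1 else - 4^-1, 0)
  end.

Definition sm_link (R : realType) (D : diagram) : set 'rV[R]_3 :=
  \bigcup_(e in [set: edge D]) (space_path (@sm_model R D) e @` `[0, 1]%classic).

(** [sm(D)] is a diagram of the link [L] in the 3-sphere. *)
Definition sm_is_diagram_of (R : realType) (D : diagram) (L : set 'rV[R]_4) : Prop :=
  ambient_isotopic (@stereo R @` @sm_link R D) L.

(** Consecutive edges along [sm(D)]. *)
Definition sm_joined (D : diagram) : rel (edge D) := fun e e' =>
  [exists j : 'I_(ndp D),
    if is_singular (kind D j) then
      ([set e; e'] == [set in_edge j false; in_edge j true])%SET
      || ([set e; e'] == [set out_edge j false; out_edge j true])%SET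
    else
      ([set e; e'] == [set in_edge j false; out_edge j true])%SET
      || ([set e; e'] == [set in_edge j true; out_edge j false])%SET].

(** [B] consists of one edge on each component of [sm(D)]. *)
Definition one_per_component (D : diagram) (B : {set edge D}) : Prop :=
  forall e : edge D, #|[set e' in B | connect (@sm_joined D) e e']%SET| = 1%N.

(** * The edge ring and the non-local ideal *)

Definition edge_ring (D : diagram) : comNzRingType := mpoly #|edge D| rat.

Definition U (D : diagram) (e : edge D) : edge_ring D :=
  mpolyX rat (mnm1 (enum_rank e)).

Definition Lminus (D : diagram) (j : 'I_(ndp D)) : edge_ring D :=
  U (out_edge j false) + U (out_edge j true)
  - U (in_edge j false) - U (in_edge j true).
Definition Lplus (D : diagram) (j : 'I_(ndp D)) : edge_ring D :=
  U (out_edge j false) + U (out_edge j true)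
  + U (in_edge j false) + U (in_edge j true).

Definition unit_disc (R : realType) : set 'rV[R]_2 := [set u | dotp u u <= 1].
Definition unit_circle (R : realType) : set 'rV[R]_2 := [set u | dotp u u = 1].

(** [f] restricts to a smooth embedding of the closed unit disc; the disc is
    [f @` unit_disc R] and its boundary [f @` unit_circle R]. *)
Definition disc_embedding (R : realType) (f : 'rV[R]_2 -> 'rV[R]_2) : Prop :=
  [/\ smooth f, {in @unit_disc R &, injective f}
    & forall u, unit_disc u -> forall v, v != 0 -> 'D_v f u != 0].

(** Parameters of the points of an edge that are not vertices. *)
Definition edge_dom (R : realType) (D : diagram) (e : edge D) : set R :=
  if e is inl _ then `]0, 1[%classic else `[0, 1[%classic.

Definition boundary_params (R : realType) (D : diagram) (I : {set crossing D})
    (f : 'rV[R]_2 -> 'rV[R]_2) (e : edge D) : set R :=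
  [set s | @edge_dom R D e s /\ (f @` @unit_circle R) (res_path R I e s)].

Definition meets_only_in_edges (R : realType) (D : diagram)
    (I : {set crossing D}) (f : 'rV[R]_2 -> 'rV[R]_2) : Prop :=
  forall j b s, s = 0 \/ s = 1 ->
    ~ (f @` @unit_circle R) (res_path R I (out_edge j b : edge D) s).

Definition meets_transversely (R : realType) (D : diagram)
    (I : {set crossing D}) (f : 'rV[R]_2 -> 'rV[R]_2) : Prop :=
  forall (e : edge D) s u, @edge_dom R D e s -> unit_circle u ->
    f u = res_path R I e s ->
    forall w, dotp u w = 0 -> 'D_1 (res_path R I e) s != 'D_w f u.

Definition in_params (R : realType) (D : diagram) (I : {set crossing D})
    (f : 'rV[R]_2 -> 'rV[R]_2) (e : edge D) : set R :=
  [set s | boundary_params I f e s /\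
           \forall s' \near s^'+, (f @` @unit_disc R) (res_path R I e s')].
Definition out_params (R : realType) (D : diagram) (I : {set crossing D})
    (f : 'rV[R]_2 -> 'rV[R]_2) (e : edge D) : set R :=
  [set s | boundary_params I f e s /\
           \forall s' \near s^'-, (f @` @unit_disc R) (res_path R I e s')].

(** Generators of [N(D_I)].  The products have one factor for each point
    where an edge crosses the boundary of the disc: an edge may cross it
    several times, possibly in both directions. *)
Definition nonlocal_relation (R : realType) (D : decorated)
    (I : {set crossing D}) : set (edge_ring D) :=
  [set g | exists (f : 'rV[R]_2 -> 'rV[R]_2) (a b : edge D -> nat),
     [/\ disc_embedding f,
         meets_only_in_edges I f /\ meets_transversely I f,
         ~ (res_path R I (deco D) @` `[0, 1]%classic `<=` f @` @unit_disc R),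
         forall e, (in_params I f e #= `I_(a e))%card /\ (out_params I f e #= `I_(b e))%card
       & g = \prod_e U e ^+ a e - \prod_e U e ^+ b e]].

(** [v_4(I)], from bottom to top. *)
Definition v4_seq (D : diagram) (I : {set crossing D}) : seq 'I_(ndp D) :=
  [seq j <- enum 'I_(ndp D) | vert4 I j && ~~ is_singular (kind D j)].

Definition resolution_connected (R : realType) (D : diagram)
    (I : {set crossing D}) : Prop :=
  connected (\bigcup_(e in [set: edge D])
               (res_path R I e @` `[0, 1]%classic)).

(** The family [D^R]. *)
Definition in_DR (R : realType) (D : decorated) : Prop :=
  column (deco D) = 0 /\
  forall I : {set crossing D},
    resolution_connected R I /\
    regular_sequence (nonlocal_relation R I) [seq Lminus j | j <- v4_seq I].

(** * Filtered complexes and their spectral sequences *)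

Record filtered_complex := FilteredComplex {
  fc_sort :> zmodType;
  fc_d : {additive fc_sort -> fc_sort};
  fc_F : int -> {pred fc_sort};
  fc_dd : forall x, fc_d (fc_d x) = 0;
  fc_F_closed : forall p, zmod_closed (fc_F p);
  fc_F_sub : forall p q, p <= q -> {subset fc_F q <= fc_F p};
  fc_F_d : forall p x, x \in fc_F p -> fc_d x \in fc_F p }.

Arguments fc_d : clear implicits.
Arguments fc_F : clear implicits.

Definition Zr (X : filtered_complex) (r p : int) : set X :=
  [set x | x \in fc_F X p /\ fc_d X x \in fc_F X (p + r)].

Definition Br (X : filtered_complex) (r p : int) : {pred X} :=
  fun x => `[< exists z w, [/\ Zr (r - 1) (p + 1) z,
                             Zr (r - 1) (p - r + 1) w & x = z + fc_d X w] >].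

Lemma Zr0 (X : filtered_complex) (r p : int) : Zr r p (0 : X).
Proof.
by split; rewrite ?raddf0;
   [case: (fc_F_closed X p)|case: (fc_F_closed X (p + r))].
Qed.

Lemma ZrB (X : filtered_complex) (r p : int) (x y : X) :
  Zr r p x -> Zr r p y -> Zr r p (x - y).
Proof.
move=> [x1 x2] [y1 y2]; split; rewrite ?raddfB.
  by have [_ FB] := fc_F_closed X p; exact: FB.
by have [_ FB] := fc_F_closed X (p + r); exact: FB.
Qed.

Lemma Br_zmod_closed (X : filtered_complex) (r p : int) :
  zmod_closed (@Br X r p).
Proof.
split.
  apply/asboolP; exists 0, 0; split; [exact: Zr0|exact: Zr0|].
  by rewrite raddf0 addr0.
move=> x y /asboolP[z [w [hz hw ->]]] /asboolP[z' [w' [hz' hw' ->]]].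
apply/asboolP; exists (z - z'), (w - w'); split; [exact: ZrB|exact: ZrB|].
by rewrite raddfB opprD addrACA.
Qed.

HB.instance Definition _ (X : filtered_complex) (r p : int) :=
  GRing.isZmodClosed.Build X (@Br X r p) (Br_zmod_closed X r p).

(** The page [E_r^p = Z_r^p / B_r^p], as a subset of [X / B_r^p]. *)
Definition coset (X : filtered_complex) (r p : int) : zmodType :=
  Quotient.quot (@Br X r p).

Definition page (X : filtered_complex) (r p : int) : set (coset X r p) :=
  (fun z => \pi_(coset X r p) z) @` @Zr X r p.

(** The differential [E_r^p -> E_r^(p + r)] induced by that of [X]. *)
Definition page_d (X : filtered_complex) (r p : int) (c : coset X r p) :
    coset X r (p + r) :=
  \pi_(coset X r (p + r)) (fc_d X (repr c)).

Lemma page_dE (X : filtered_complex) (r p : int) (z : X) :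
  page_d (\pi_(coset X r p) z) = \pi_(coset X r (p + r)) (fc_d X z).
Proof.
rewrite /page_d; set y := repr _.
have /asboolP[a [b [ha _ yE]]] : y - z \in @Br X r p.
  by rewrite Quotient.idealrBE reprK.
apply/eqP; rewrite -Quotient.idealrBE -raddfB yE raddfD fc_dd addr0.
by apply/asboolP; exists 0, a; split; rewrite ?add0r ?addrK //; exact: Zr0.
Qed.

(** [E_r^(h, q)] inside [E_r^p]: the cube grading [p] and the grading
    [gr2 : int -> set X] give [gr_h] and [gr_q = gr_2 + 2 gr_h] up to the
    overall shifts [sh] and [sq]. *)
Definition bigraded_piece (X : filtered_complex) (gr2 : int -> set X)
    (sh sq r p h q : int) : set (coset X r p) :=
  [set c | h = p + sh /\
     exists z, [/\ Zr r p z, gr2 (q - 2 * h - sq) z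
                 & c = \pi_(coset X r p) z]].

(** * The reduced complex *)

(** For [B] a set of edges, a basis element [(I, A, C)] stands for the cube
    vertex [I], the copy of [R] indexed by [A] in the Koszul matrix
    factorization, and the copy indexed by [C] in the tensor product of the
    [R -> R] with maps [U e], [e \in B]. *)
Definition basis (D : diagram) (B : {set edge D}) : finType :=
  ({set crossing D} * {set singpt D} * {set {e : edge D | e \in B}})%type.

Definition chains (D : diagram) (B : {set edge D}) : zmodType :=
  {ffun basis B -> edge_ring D}.

Definition cube_gr (D : diagram) (B : {set edge D}) (i : basis B) : nat :=
  (#|i.1.1| + #|i.2|)%N.

(** The ideal [N(D_I) + L_I(D_I)]. *)
Definition vertex_ideal (R : realType) (D : decorated) (I : {set crossing D}) :
    set (edge_ring D) :=
  ideal_gen (nonlocal_relation R I `|` [set` [seq Lminus j | j <- v4_seq I]]).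

Definition vanishing (R : realType) (D : decorated) (B : {set edge D}) :
    {pred chains B} :=
  fun x => `[< forall i : basis B, vertex_ideal R i.1.1 (x i) >].

Lemma vanishing_zmod_closed (R : realType) (D : decorated) (B : {set edge D}) :
  zmod_closed (@vanishing R D B).
Proof.
split.
  by apply/asboolP => i; rewrite ffunE; exact: ideal_gen0.
move=> x y /asboolP hx /asboolP hy; apply/asboolP => i.
by rewrite !ffunE; apply: ideal_genB (hx i) (hy i).
Qed.

HB.instance Definition _ (R : realType) (D : decorated) (B : {set edge D}) :=
  GRing.isZmodClosed.Build (chains B) (@vanishing R D B)
    (vanishing_zmod_closed R B).

(** The direct sum over [basis B] of the quotients [R / (N(D_I) + L_I(D_I))]. *)
Definition chat (R : realType) (D : decorated) (B : {set edge D}) : zmodType :=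
  Quotient.quot (@vanishing R D B).

(** The value at 1 of the edge map out of a cube vertex in direction [c]. *)
Definition edge_coef (D : diagram) (c : crossing D) : edge_ring D :=
  if kind D (val c) is Negative then
    U (out_edge (val c) true) - U (in_edge (val c) false)
  else 1.

(** [eps I c], for [c \notin I], is the sign exponent of the cube edge from [I]
    to [c |: I]. *)
Definition edge_signs (D : diagram) (eps : {set crossing D} -> crossing D -> bool) :
    Prop :=
  forall (I : {set crossing D}) (c c' : crossing D), c != c' -> c \notin I -> c' \notin I ->
    eps I c (+) eps (c |: I) c' (+) eps I c' (+) eps (c' |: I) c = true.

(** The differential, on the free [R]-module [chains B].  The exponents
    [#|I|] and [#|I| + #|A|] are the usual signs of tensor products; they make
    [d_1], [d_0] and the maps [U e] anticommute. *)
Definition chains_d (D : diagram) (eps : {set crossing D} -> crossing D -> bool)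
    (B : {set edge D}) (x : chains B) : chains B :=
  [ffun i : basis B => let: (J, A, C) := i in
    \sum_(c in J) (-1) ^+ eps (J :\ c) c * (edge_coef c * x (J :\ c, A, C))
    + (-1) ^+ #|J| *
      \sum_(v : singpt D) (-1) ^+ #|[set u in A | (val u < val v)%N]%SET| *
        (if v \in A then Lminus (val v) * x (J, A :\ v, C)
         else Lplus (val v) * x (J, v |: A, C))
    + (-1) ^+ (#|J| + #|A|) *
      \sum_(e in C)
        (-1) ^+ #|[set e' in C | (enum_rank e' < enum_rank e)%N]%SET| *
        (U (val e) * x (J, A, C :\ e))].

(** A reduced complex of [D]: a choice of signs and of one edge on each
    component of [sm(D)], with the induced differential on the quotient, which
    [rc_dE] determines since [\pi] is surjective. *)
Record reduced_complex (R : realType) (D : decorated) := ReducedComplex {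
  rc_eps : {set crossing D} -> crossing D -> bool;
  rc_epsP : edge_signs rc_eps;
  rc_edges : {set edge D};
  rc_edgesP : one_per_component rc_edges;
  rc_d : {additive chat R rc_edges -> chat R rc_edges};
  rc_dE : forall x : chains rc_edges,
    rc_d (\pi_(chat R rc_edges) x) = \pi_(chat R rc_edges) (chains_d rc_eps x);
  rc_dd : forall x, rc_d (rc_d x) = 0 }.

(** Chains supported in cube grading at least [p]. *)
Definition chains_F (D : diagram) (B : {set edge D}) (p : int) : set (chains B) :=
  [set x | forall i, x i != 0 -> p <= (cube_gr i)%:Z].

Definition cube_F (R : realType) (D : decorated) (B : {set edge D}) (p : int) :
    {pred chat R B} :=
  fun y => `[< exists2 x : chains B, chains_F p x & y = \pi_(chat R B) x >].

(** Chains homogeneous of degree [s] for [gr_2]; a monomial of degree [n] times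
    a generator of the summand of [I] has degree
    [|v_4(D_I)| - |I| - 2 n]. *)
Definition chains_gr2 (D : diagram) (B : {set edge D}) (s : int) : set (chains B) :=
  [set x | forall (i : basis B) (m : multinom #|edge D|), m \in msupp (x i) ->
     #|[set j | vert4 i.1.1 j]%SET|%:Z - #|i.1.1|%:Z - 2 * (mdeg m)%:Z = s].

Lemma cube_F_closed (R : realType) (D : decorated) (B : {set edge D}) (p : int) :
  zmod_closed (@cube_F R D B p).
Proof.
split.
  apply/asboolP; exists 0; first by move=> i; rewrite ffunE eqxx.
  by rewrite raddf0.
move=> _ _ /asboolP[x hx ->] /asboolP[y hy ->]; apply/asboolP.
exists (x - y); last by rewrite raddfB.
move=> i; rewrite !ffunE => xy; have [x0|/hx //] := eqVneq (x i) 0.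
by apply: hy; apply: contraNneq xy => y0; rewrite x0 y0 subr0.
Qed.

Lemma cube_F_sub (R : realType) (D : decorated) (B : {set edge D}) (p q : int) :
  p <= q -> {subset @cube_F R D B q <= @cube_F R D B p}.
Proof.
move=> pq _ /asboolP[x hx ->]; apply/asboolP; exists x => // i xi.
exact: le_trans pq (hx _ xi).
Qed.

Lemma cube_F_d (R : realType) (D : decorated) (X : reduced_complex R D)
    (p : int) (y : chat R (rc_edges X)) :
  y \in @cube_F R D (rc_edges X) p -> rc_d X y \in @cube_F R D (rc_edges X) p.
Proof.
move=> /asboolP[x hx ->]; rewrite rc_dE; apply/asboolP.
exists (chains_d (rc_eps X) x) => // -[[J A] C]; rewrite ffunE /=.
apply: contraNT; rewrite -ltNge => hp.
have x0 i : (cube_gr i <= #|J| + #|C|)%N -> x i = 0.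
  move=> hi; apply/eqP; apply: contraLR hp => /hx pi.
  by rewrite -leNgt (le_trans pi) // lez_nat.
apply/eqP; rewrite !big1 ?mulr0 ?addr0 //.
- move=> e eC; rewrite x0 ?mulr0 // /cube_gr /= leq_add2l.
  exact/subset_leq_card/subsetDl.
- by move=> v _; rewrite !x0 ?mulr0 ?if_same ?mulr0.
- move=> c cI; rewrite x0 ?mulr0 // /cube_gr /= leq_add2r.
  exact/subset_leq_card/subsetDl.
Qed.

(** The reduced complex with the cube filtration. *)
Definition cube_complex (R : realType) (D : decorated) (X : reduced_complex R D) :
    filtered_complex :=
  @FilteredComplex (chat R (rc_edges X)) (rc_d X) (@cube_F R D (rc_edges X))
    (@rc_dd R D X) (@cube_F_closed R D (rc_edges X))
    (@cube_F_sub R D (rc_edges X)) (@cube_F_d R D X).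

Definition cube_gr2 (R : realType) (D : decorated) (X : reduced_complex R D)
    (s : int) : set (cube_complex X) :=
  (fun x : chains (rc_edges X) => \pi_(chat R (rc_edges X)) x) @` chains_gr2 s.

(** The page [E_k] is numbered [2 k + 3] for the cube filtration.
    [Ek X k p] is its summand of cube grading [p] and [Ek_piece X sh sq k p h q]
    the part of that summand in bigrading [(gr_h, gr_q) = (h, q)]. *)
Definition Ek (R : realType) (D : decorated) (X : reduced_complex R D)
    (k : nat) (p : int) : set (coset (cube_complex X) (2 * k + 3)%N%:Z p) :=
  @page (cube_complex X) (2 * k + 3)%N%:Z p.
Arguments Ek {R D} X k p _.

Definition Ek_piece (R : realType) (D : decorated) (X : reduced_complex R D)
    (sh sq : int) (k : nat) (p h q : int) :
    set (coset (cube_complex X) (2 * k + 3)%N%:Z p) :=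
  Ek X k p `&` bigraded_piece (@cube_gr2 R D X) sh sq h q.
Arguments Ek_piece {R D} X sh sq k p h q _.

Definition dk (R : realType) (D : decorated) (X : reduced_complex R D)
    (k : nat) (p : int) (c : coset (cube_complex X) (2 * k + 3)%N%:Z p) :
    coset (cube_complex X) (2 * k + 3)%N%:Z (p + (2 * k + 3)%N%:Z) :=
  page_d c.
Arguments dk {R D} X k p c.

(* Main.v *)
(** The differential of the reduced complex lowers [gr_2] by exactly 2, already
    on the free [R]-module of chains: the maps [U e], [L(v)], [L^+(v)] are linear
    in variables of degree -2 and do not move the cube vertex; the edge map of a
    positive crossing has degree 0 but [|v_4(D_I)| - |I|] drops by 2, while for a
    negative crossing [|v_4(D_I)| - |I|] is unchanged and the edge map is linear.
    A differential on page [2k+3] raises [gr_h] by [2k+3], hence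
    [gr_q = gr_2 + 2 gr_h] by [-2 + 2(2k+3) = 4k+4]. *)

Require Import Defs.
From HB Require Import structures.
From mathcomp Require Import all_boot all_order all_algebra.
From mathcomp Require Import all_classical all_reals all_analysis.
From mathcomp Require Import zify.
From mathcomp Require Import -(notations) mpoly.
Import Order.TTheory GRing.Theory Num.Theory.
Import numFieldNormedType.Exports.
Local Open Scope ring_scope.

(** Each variable has degree 2, so that [gr_2] is the cube-vertex term
    [vertex_gr2] below minus this degree. *)
Definition homogeneous n (t : int) (f : mpoly n rat) : Prop :=
  forall m, m \in msupp f -> 2 * (mdeg m)%:Z = t.
Arguments homogeneous {n}.

(** Vacuous, as the support is empty: zero is homogeneous in every degree, so vanishing terms of the
    differential impose no constraint. *)
Lemma homogeneous0 n t : homogeneous t (0 : mpoly n rat).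
Proof. by move=> m; rewrite msupp0. Qed.

Lemma homogeneousD n t (f g : mpoly n rat) :
  homogeneous t f -> homogeneous t g -> homogeneous t (f + g).
Proof.
move=> hf hg m /msuppD_le; rewrite mem_cat => /orP[/hf|/hg] //.
Qed.

Lemma homogeneousN n t (f : mpoly n rat) :
  homogeneous t f -> homogeneous t (- f).
Proof. by move=> hf m; rewrite (perm_mem (msuppN _)); exact: hf. Qed.

Lemma homogeneous_sign n t (f : mpoly n rat) i :
  homogeneous t f -> homogeneous t ((-1) ^+ i * f).
Proof.
rewrite -signr_odd; case: (odd i) => hf; last by rewrite mul1r.
by rewrite mulN1r; exact: homogeneousN.
Qed.

Lemma homogeneousM n s t (f g : mpoly n rat) :
  homogeneous s f -> homogeneous t g -> homogeneous (s + t) (f * g).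
Proof.
move=> hf hg m /msuppM_le /allpairsP[[m1 m2] /= [/hf <- /hg <- ->]].
by rewrite mdegD PoszD mulrDr.
Qed.

Lemma homogeneous_sum n t (I : Type) (r : seq I) (P : pred I)
    (F : I -> mpoly n rat) :
  (forall i, P i -> homogeneous t (F i)) ->
  homogeneous t (\sum_(i <- r | P i) F i).
Proof.
by apply: big_ind => [|f g]; [exact: homogeneous0|exact: homogeneousD].
Qed.

Lemma homogeneous_U (D : diagram) (e : edge D) : homogeneous 2 (U e).
Proof. by move=> m; rewrite msuppX inE => /eqP ->; rewrite mdeg1 mulr1. Qed.

Lemma homogeneous_Lminus (D : diagram) (j : 'I_(ndp D)) :
  homogeneous 2 (Lminus j).
Proof.
by do ![apply: homogeneousD | apply: homogeneousN]; exact: homogeneous_U.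
Qed.

Lemma homogeneous_Lplus (D : diagram) (j : 'I_(ndp D)) :
  homogeneous 2 (Lplus j).
Proof. by do !apply: homogeneousD; exact: homogeneous_U. Qed.

Lemma homogeneous1 n : homogeneous 0 (1 : mpoly n rat).
Proof. by move=> m; rewrite msupp1 inE => /eqP ->; rewrite mdeg0. Qed.

Definition vertex_gr2 (D : diagram) (I : {set crossing D}) : int :=
  #|[set j | vert4 I j]%SET|%:Z - #|I|%:Z.
Arguments vertex_gr2 {D}.

(** Reduces [gr_2] to polynomial degree; the target degree depends only on the cube vertex, since
    the Koszul indices [A] and [C] carry no [gr_2] of their own. *)
Lemma chains_gr2P (D : diagram) (B : {set edge D}) (s : int) (x : chains B) :
  chains_gr2 s x <->
  forall i, homogeneous (vertex_gr2 i.1.1 - s) (x i).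
Proof.
rewrite /vertex_gr2.
by split=> hx i m mi; have := hx i m mi; [move=> <-|move=> ->]; rewrite subKr.
Qed.

Lemma vert4D1 (D : diagram) (I : {set crossing D}) (c : crossing D) j :
  j != val c -> vert4 (I :\ c) j = vert4 I j.
Proof.
move=> jc; rewrite /vert4.
suff -> : (j \in [seq val c' | c' in I :\ c]) = (j \in [seq val c' | c' in I]).
  by [].
apply/mapP/mapP => -[c']; rewrite !mem_enum.
  by rewrite !inE => /andP[_ cI] ->; exists c' => //; rewrite mem_enum.
move=> cI jE; exists c' => //; rewrite mem_enum !inE cI andbT.
by apply: contraNneq jc => <-; apply/eqP.
Qed.

Lemma mem_vals (D : diagram) (I : {set crossing D}) (c : crossing D) :
  (val c \in [seq val c' | c' in I]) = (c \in I).
Proof. by rewrite mem_map ?mem_enum //; exact: val_inj. Qed.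

Lemma homogeneous_edge_coef (D : diagram) (I : {set crossing D}) (c : crossing D) :
  c \in I ->
  homogeneous (vertex_gr2 I - vertex_gr2 (I :\ c) + 2) (edge_coef c).
Proof.
move=> cI; rewrite /vertex_gr2 (cardsD1 c I) cI.
(* Splitting off [val c] leaves equal remainders, because the two resolutions differ only there. *)
rewrite (cardsD1 (val c) [set j | vert4 I j]%SET).
rewrite (cardsD1 (val c) [set j | vert4 (I :\ c) j]%SET).
have -> : ([set j | vert4 (I :\ c) j] :\ val c = [set j | vert4 I j] :\ val c)%SET.
  by apply/setP => j; rewrite !inE; case: eqVneq => //= /vert4D1 ->.
rewrite /edge_coef !inE /vert4 !mem_vals setD11 cI.
(* [valP c] excludes singular points. With [c] in [I], a positive crossing is smoothed and a
   negative one is a vertex; removing [c] exchanges these. *)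
move: (valP c); case: (kind D (val c)) => //= _.
  by set n := #|_|; set m := #|_|; rewrite (_ : _ + 2 = 0); [exact: homogeneous1|lia].
set n := #|_|; set m := #|_|; rewrite (_ : _ + 2 = 2); last by lia.
by apply: homogeneousD; [|apply: homogeneousN]; exact: homogeneous_U.
Qed.

Lemma chains_gr2_d (D : diagram) (eps : {set crossing D} -> crossing D -> bool)
    (B : {set edge D}) (s : int) (x : chains B) :
  chains_gr2 s x -> chains_gr2 (s - 2) (chains_d eps x).
Proof.
move=> /chains_gr2P hx; apply/chains_gr2P => -[[J A] C] /=; rewrite ffunE.
have -> : vertex_gr2 J - (s - 2) = 2 + (vertex_gr2 J - s) by lia.
apply: homogeneousD; first apply: homogeneousD.
- apply: homogeneous_sum => c cJ; apply: homogeneous_sign.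
  (* Telescoping through [J :\ c]: the jump of [vertex_gr2] along the cube edge is absorbed by the
     degree of [edge_coef c]. *)
  have -> : 2 + (vertex_gr2 J - s) =
    vertex_gr2 J - vertex_gr2 (J :\ c) + 2 + (vertex_gr2 (J :\ c) - s) by lia.
  by apply: homogeneousM; [exact: homogeneous_edge_coef | exact: (hx (J :\ c, A, C))].
- apply: homogeneous_sign; apply: homogeneous_sum => v _.
  apply: homogeneous_sign; case: ifP => _.
    by apply: homogeneousM; [exact: homogeneous_Lminus | exact: (hx (J, A :\ v, C))].
  by apply: homogeneousM; [exact: homogeneous_Lplus | exact: (hx (J, v |: A, C))].
- apply: homogeneous_sign; apply: homogeneous_sum => e _.
  apply: homogeneous_sign; apply: homogeneousM; first exact: homogeneous_U.
  exact: (hx (J, A, C :\ e)).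
Qed.

(** The boundary of [z] is a cycle, and zero lies in every filtration step; hence [page_d] lands in
    the page. *)
Lemma Zr_d (Y : filtered_complex) (r p : int) (z : Y) :
  Zr r p z -> Zr r (p + r) (fc_d Y z).
Proof.
move=> [_ dz]; split=> //.
by rewrite fc_dd; case: (fc_F_closed Y (p + r + r)).
Qed.

Theorem theorem1p3 (R : realType) (K : set 'rV[R]_4) (D : decorated)
    (X : reduced_complex R D) (sh sq : int) (k : nat) :
  is_knot K ->
  in_DR R D ->
  sm_is_diagram_of D (mirror K) ->
  forall (p h q : int) (c : coset (cube_complex X) (2 * k + 3)%N%:Z p),
    Ek_piece X sh sq k p h q c ->
    Ek_piece X sh sq k (p + (2 * k + 3)%N%:Z)
      (h + (2 * k + 3)%N%:Z) (q + (4 * k + 4)%N%:Z) (dk X k p c).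
Proof.
move=> _ _ _ p h q _ [_ [-> [z [Zz [x hx xz] ->]]]].
have Zdz := Zr_d _ _ _ _ Zz; rewrite /dk page_dE.
split; first by exists (fc_d (cube_complex X) z).
split; first by lia.
exists (fc_d (cube_complex X) z); split=> //.
(* The differential of the homogeneous lift [x] of [z] is a homogeneous lift of its boundary. *)
exists (chains_d (rc_eps X) x); last by rewrite -rc_dE xz.
have -> : q + (4 * k + 4)%N%:Z - 2 * (p + sh + (2 * k + 3)%N%:Z) - sq
  = q - 2 * (p + sh) - sq - 2 by lia.
exact: chains_gr2_d.
Qed.
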